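(* Let $\mathcal T$ be a subsequential, complete, finally connected, finally aperiodic transducer with output alphabet $\mathcal A_O=\{0,1\}$. Then the asymptotic variance $v_2$ of the output sum is $0$ if and only if either all transitions of the final component have output label $0$ or all transitions of the final component have output label $1$; that is, the only output weights of the final component with asymptotic variance $v_2=0$ are $(0,\dots,0)$ and $(1,\dots,1)$.
   Context: A transducer consists of a finite set of states $\{1,\dots,S\}$, a finite input alphabet $\mathcal A_I\subseteq\mathbb R$ (with at least two elements), an output alphabet $\mathcal A_O\subseteq\mathbb R$, a set of transitions $\mathcal E\subseteq\{1,\dots,S\}^2\times\mathcal A_I$, output labels $\delta\colon\mathcal E\to\mathcal A_O$, and the initial state $1$. A transition $e=(s,t,\varepsilon)$ goes from $s$ to $t$ and has input label $\varepsilon$ and output label $\delta(e)$. The underlying graph is the directed multigraph (loops and parallel edges allowed) whose vertices are the states and whose edges are the transitions. The transducer is deterministic if for every state $s$ and $\varepsilon\in\mathcal A_I$ there is at most one $t$ with $(s,t,\varepsilon)\in\mathcal E$; complete if for every $s$ and $\varepsilon$ there is some such $t$; subsequential if it is deterministic, every state is final, and it has a final output $a\colon\{1,\dots,S\}\to\mathcal A_O$. It is finally connected if some state can be reached from every other state; its final component is then the transducer induced by the set of all states which can be reached from every other state. A finally connected transducer is finally aperiodic if the underlying graph of the final component is aperiodic (the gcd of the lengths of all closed walks starting and ending at a given vertex is $1$). The output of the transducer on an input word is the sequence of output labels along the unique path starting at state $1$ whose input labels are the word (read in a fixed direction, from right to left), together with the final output label of the last state of this path. $X_n$ is uniformly distributed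 on $\mathcal A_I^n$ and $\mathsf{Output}(X_n)$ is the sum of its output sequence. There is a constant $v_2$ with $\mathbb V(\mathsf{Output}(X_n))=v_2n+\mathcal O(1)$; it is called the asymptotic variance of the output sum. *)

(* Defs.v *)
From HB Require Import structures.
From mathcomp Require Import all_boot all_order all_algebra finmap.
From mathcomp Require Import all_classical all_reals all_analysis.

Set Implicit Arguments.
Unset Strict Implicit.
Unset Printing Implicit Defensive.
Import Order.TTheory GRing.Theory Num.Theory.
Import numFieldNormedType.Exports.
Local Open Scope ring_scope.

(* The states 1, ..., S are represented by 'I_S, shifted by one, so that the
   initial state 1 is the ordinal 0.  A transition (s, t, eps) is a nested pair
   ((s, t), eps); [out_label] is only meaningful on [transitions]. *)
Record transducer (R : realType) : Type := Transducer {
  nstates : nat;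
  nstates_gt0 : (0 < nstates)%N;
  in_alphabet : {fset R};
  in_alphabet_ge2 : (1 < #|` in_alphabet|)%N;
  out_alphabet : set R;
  transitions : {set 'I_nstates * 'I_nstates * in_alphabet};
  out_label : 'I_nstates * 'I_nstates * in_alphabet -> R;
  out_labelP : forall e, e \in transitions -> out_alphabet (out_label e)
}.

Notation state T := 'I_(nstates T).
Notation transition T :=
  ('I_(nstates T) * 'I_(nstates T) * in_alphabet T)%type.

Definition initial_state (R : realType) (T : transducer R) : state T :=
  Ordinal (nstates_gt0 T).

Definition deterministic (R : realType) (T : transducer R) : Prop :=
  forall (s t t' : state T) (eps : in_alphabet T),
    (s, t, eps) \in transitions T -> (s, t', eps) \in transitions T -> t = t'.

Definition complete_transducer (R : realType) (T : transducer R) : Prop :=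
  forall (s : state T) (eps : in_alphabet T),
    exists t : state T, (s, t, eps) \in transitions T.

(* That every state is final is expressed by the final output [a] being a total
   function on the states. *)
Definition subsequential (R : realType) (T : transducer R)
    (a : state T -> R) : Prop :=
  deterministic T /\ forall s : state T, out_alphabet T (a s).

Arguments subsequential [R] T a.

Definition adjacent (R : realType) (T : transducer R) : rel (state T) :=
  [rel s t | [exists eps : in_alphabet T, (s, t, eps) \in transitions T]].

Definition final_states (R : realType) (T : transducer R) : {set state T} :=
  [set s | [forall t, connect (@adjacent R T) t s]]%SET.

Definition finally_connected (R : realType) (T : transducer R) : Prop :=
  exists s : state T, s \in final_states T.

Definition final_transitions (R : realType) (T : transducer R) :
    {set transition T} :=
  [set e in transitions T |
    (e.1.1 \in final_states T) && (e.1.2 \in final_states T)]%SET.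

Fixpoint is_walk (V L : finType) (E : {set V * V * L}) (s : V)
    (p : seq (V * V * L)) (t : V) : bool :=
  if p is e :: p' then [&& e \in E, e.1.1 == s & is_walk E e.1.2 p' t]
  else s == t.

Definition is_gcd (P : nat -> Prop) (g : nat) : Prop :=
  forall d : nat, (d %| g)%N <-> (forall l, P l -> (d %| l)%N).

(* The multigraph with vertex set A and edge set E, an edge ((s, t), l) going
   from s to t. *)
Definition aperiodic (V L : finType) (A : {set V}) (E : {set V * V * L}) :
    Prop :=
  forall s : V, s \in A ->
    is_gcd (fun l => exists2 p, is_walk E s p s & size p = l) 1.

Definition finally_aperiodic (R : realType) (T : transducer R) : Prop :=
  aperiodic (final_states T) (final_transitions T).

(* For a complete deterministic transducer the [pick] below always finds the
   unique successor of s. *)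
Fixpoint output_from (R : realType) (T : transducer R) (a : state T -> R)
    (s : state T) (w : seq (in_alphabet T)) : seq R :=
  if w is eps :: w' then
    if [pick t | (s, t, eps) \in transitions T] is Some t then
      out_label (s, t, eps) :: output_from a t w'
    else [::]
  else [:: a s].

(* Words are read from right to left, hence the [rev]. *)
Definition output_sum (R : realType) (T : transducer R) (a : state T -> R)
    (n : nat) (w : n.-tuple (in_alphabet T)) : R :=
  \sum_(x <- output_from a (initial_state T) (rev w)) x.

Definition uniform_expectation (R : realType) (Omega : finType)
    (X : Omega -> R) : R :=
  (\sum_w X w) / #|Omega|%:R.

Definition uniform_variance (R : realType) (Omega : finType)
    (X : Omega -> R) : R :=
  uniform_expectation (fun w => (X w - uniform_expectation X) ^+ 2).

Local Open Scope classical_set_scope.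

Definition is_asymptotic_variance (R : realType) (T : transducer R)
    (a : state T -> R) (v : R) : Prop :=
  (fun n : nat => uniform_variance (@output_sum R T a n)) =
  (fun n : nat => v * n%:R) +O_\oo (fun _ : nat => 1 : R).

Arguments is_asymptotic_variance [R] T a v.

(* Main.v *)
(* If [v2 = 0], the variance is bounded along all lengths.  Two closed words of
   the same length at a final state with different weights could be inserted
   after any word leading to that state; by the law of total variance each
   block of letters in which this choice is available adds a positive constant
   to the variance, which would then be unbounded.  Hence the weight of a closed
   word is a function of its length, and so a constant [c] times its length.
   By aperiodicity [c] is an integer, and as the labels are 0 or 1, [c] is 0 or
   1 and all labels on closed words equal [c].  Conversely, if all final labels
   equal [c], the output minus [c n] only varies until the final component is
   reached, and this waiting time has a bounded second moment. *)
Require Import Defs.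
From HB Require Import structures.
From mathcomp Require Import all_boot all_order all_algebra finmap.
From mathcomp Require Import all_classical all_reals all_analysis.
From mathcomp Require Import zify ring lra.

Set Implicit Arguments.
Unset Strict Implicit.
Unset Printing Implicit Defensive.
Import Order.TTheory GRing.Theory Num.Theory.
Import numFieldNormedType.Exports.
Local Open Scope ring_scope.

(** * Mean and variance on a finite uniform probability space *)

Section UniformExpectation.
Variables (R : realType) (Omega : finType).
Implicit Types X Y : Omega -> R.

Local Notation E := (@uniform_expectation R Omega).

Lemma eq_uexp X Y : X =1 Y -> E X = E Y.
Proof. by move=> eqXY; congr (_ / _); apply: eq_bigr => w _; apply: eqXY. Qed.

Lemma eq_uvar X Y : X =1 Y -> uniform_variance X = uniform_variance Y.
Proof.
by move=> eqXY; apply: eq_uexp => w; rewrite (eq_uexp eqXY) eqXY.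
Qed.

Lemma uexpD X Y : E (fun w => X w + Y w) = E X + E Y.
Proof. by rewrite /uniform_expectation big_split /= mulrDl. Qed.

Lemma uexpZ c X : E (fun w => c * X w) = c * E X.
Proof. by rewrite /uniform_expectation -mulr_sumr mulrA. Qed.

Lemma ler_uexp X Y : (forall w, X w <= Y w) -> E X <= E Y.
Proof.
by move=> leXY; rewrite ler_wpM2r ?invr_ge0 ?ler0n//; apply: ler_sum => w _.
Qed.

Lemma uexp_ge0 X : (forall w, 0 <= X w) -> 0 <= E X.
Proof.
by move=> X0; rewrite mulr_ge0 ?invr_ge0 ?ler0n// sumr_ge0.
Qed.

Lemma uvar_ge0 X : 0 <= uniform_variance X.
Proof. by apply: uexp_ge0 => w; rewrite sqr_ge0. Qed.

Lemma uexp_ge_point X w : (forall w, 0 <= X w) -> X w / #|Omega|%:R <= E X.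
Proof.
move=> X0; rewrite ler_wpM2r ?invr_ge0 ?ler0n//.
by rewrite (bigD1 w)//= lerDl sumr_ge0.
Qed.

Lemma uexp_bij X (h : Omega -> Omega) : bijective h -> E (X \o h) = E X.
Proof.
by move=> hbij; congr (_ / _); rewrite [RHS](reindex h)//; apply: onW_bij.
Qed.

Lemma uvar_bij X (h : Omega -> Omega) :
  bijective h -> uniform_variance (X \o h) = uniform_variance X.
Proof.
move=> hbij; rewrite /uniform_variance (uexp_bij _ hbij).
exact: (uexp_bij (fun w => (X w - E X) ^+ 2)).
Qed.

Hypothesis Omega_gt0 : (0 < #|Omega|)%N.

Lemma uexp_cst c : E (fun=> c) = c.
Proof.
rewrite /uniform_expectation sumr_const -(mulr_natr c) mulfK//.
by rewrite pnatr_eq0 -lt0n.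
Qed.

Lemma uexp_sqrB X c :
  E (fun w => (X w - c) ^+ 2) = uniform_variance X + (E X - c) ^+ 2.
Proof.
rewrite -[X in _ + X]uexp_cst /uniform_variance -uexpD.
set m := E X.
have cross : E (fun w => 2 * (m - c) * (X w + - m)) = 0.
  by rewrite uexpZ uexpD uexp_cst subrr mulr0.
rewrite -[RHS]addr0 -[X in _ = _ + X]cross -uexpD; apply: eq_uexp => w; ring.
Qed.

Lemma uvar_le_sqrB X c : uniform_variance X <= E (fun w => (X w - c) ^+ 2).
Proof. by rewrite uexp_sqrB lerDl sqr_ge0. Qed.

End UniformExpectation.

(** Concatenation is a bijection from pairs of words, so prefix and suffix of a uniform word are
    independent and uniform. *)
Lemma uexp_cat (R : realType) (A : finType) (m n : nat) (F : seq A -> R) :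
  uniform_expectation (fun w : (m + n).-tuple A => F w) =
  uniform_expectation (fun u : m.-tuple A =>
    uniform_expectation (fun w : n.-tuple A => F (u ++ w))).
Proof.
rewrite /uniform_expectation -mulr_suml -mulrA; congr (_ * _); last first.
  by rewrite !card_tuple expnD natrM invfM mulrC.
rewrite pair_big /=.
rewrite (reindex (fun p : m.-tuple A * n.-tuple A => cat_tuple p.1 p.2))//=.
pose split_tuple (w : (m + n).-tuple A) : m.-tuple A * n.-tuple A :=
  (tcast (minn_idPl (leq_addr n m)) (take_tuple m w),
   tcast (addKn m n) (drop_tuple m w)).
exists split_tuple => [[u w]|w] _.
  by congr pair; apply: val_inj; rewrite /= val_tcast /=
    ?take_size_cat ?drop_size_cat ?size_tuple.
by apply: val_inj; rewrite /= !val_tcast /= cat_take_drop.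
Qed.

(** * Weights of closed words in an automaton with 0/1 labels *)

Section Automaton.
Variables (R : realType) (Q A : finType) (next : Q -> A -> Q).
Variables (label : Q -> A -> bool) (a : Q -> R).

Definition run (s : Q) (w : seq A) : Q := foldl next s w.

(** Kept in [nat], apart from the final output, so that divisibility arguments apply. *)
Fixpoint weight (s : Q) (w : seq A) : nat :=
  if w is x :: w' then (label s x + weight (next s x) w')%N else 0.

Definition output (s : Q) (w : seq A) : R := (weight s w)%:R + a (run s w).

Definition output_var (n : nat) (s : Q) : R :=
  uniform_variance (fun w : n.-tuple A => output s w).

Lemma run_cat s u w : run s (u ++ w) = run (run s u) w.
Proof. exact: foldl_cat. Qed.

Lemma weight_cat s u w :
  weight s (u ++ w) = (weight s u + weight (run s u) w)%N.
Proof. by elim: u s => //= x u IH s; rewrite IH addnA. Qed.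

Lemma output_cat s u w :
  output s (u ++ w) = (weight s u)%:R + output (run s u) w.
Proof. by rewrite /output run_cat weight_cat natrD addrA. Qed.

Lemma weight_le_size s w : (weight s w <= size w)%N.
Proof.
by elim: w s => //= x w IH s; rewrite -add1n leq_add// leq_b1.
Qed.

Definition closed_word (s : Q) (w : seq A) : Prop := run s w = s.

Lemma closed_word_flatten_nseq s w k : closed_word s w ->
  closed_word s (flatten (nseq k w)) /\
  weight s (flatten (nseq k w)) = (k * weight s w)%N.
Proof.
move=> sw; elim: k => [//|k [IHr IHw]] /=.
by rewrite /closed_word run_cat sw weight_cat sw IHw mulSn.
Qed.

(* The common slope [weight / size] of the closed words at [s] is an integer:
   its reduced denominator divides all their lengths. *)
Lemma closed_weight_dichotomy s :
  (forall u w, closed_word s u -> closed_word s w -> size u = size w ->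
    weight s u = weight s w) ->
  (forall d, (forall w, closed_word s w -> (d %| size w)%N) -> (d %| 1)%N) ->
  (forall w, closed_word s w -> weight s w = 0%N) \/
  (forall w, closed_word s w -> weight s w = size w).
Proof.
move=> same gcd1.
have [[w0 [sw0 w0_gt0]]|no] := pselect
    (exists w, closed_word s w /\ (0 < size w)%N); last first.
  by left=> w sw; case: w sw => // x w sw; case: no; exists (x :: w).
(* Repeating [w0] and [w] to a common length gives closed words of equal weight, so the slopes
   agree. *)
have prop w : closed_word s w ->
    (weight s w * size w0 = weight s w0 * size w)%N.
  move=> sw.
  have [c1 e1] := closed_word_flatten_nseq (size w) sw0.
  have [c2 e2] := closed_word_flatten_nseq (size w0) sw.
  rewrite mulnC -e2 [RHS]mulnC -e1; apply: same => //.
  by rewrite !size_flatten /shape !map_nseq !sumn_nseq mulnC.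
set g := gcdn (size w0) (weight s w0).
have g_gt0 : (0 < g)%N by rewrite gcdn_gt0 w0_gt0.
have Ew0 : size w0 = ((size w0 %/ g) * g)%N by rewrite divnK ?dvdn_gcdl.
have Ef0 : weight s w0 = ((weight s w0 %/ g) * g)%N.
  by rewrite divnK ?dvdn_gcdr.
have cop : coprime (size w0 %/ g) (weight s w0 %/ g).
  by rewrite /coprime -(eqn_pmul2r g_gt0) muln_gcdl -Ew0 -Ef0 mul1n.
have : (size w0 %/ g %| 1)%N.
  apply: gcd1 => w sw; rewrite -(Gauss_dvdr _ cop).
  apply/dvdnP; exists (weight s w); apply/eqP.
  by rewrite -(eqn_pmul2r g_gt0) mulnAC -Ef0 -mulnA -Ew0 prop.
rewrite dvdn1 => /eqP d1; move: Ew0; rewrite d1 mul1n => Ew0.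
have le := weight_le_size s w0.
have dv : (size w0 %| weight s w0)%N by rewrite Ew0 dvdn_gcdr.
(* [size w0] divides [weight s w0], which is at most [size w0]: the slope is 0 or 1. *)
have [z|nz] := posnP (weight s w0).
  left=> w /prop; rewrite z mul0n => /eqP.
  by rewrite muln_eq0 => /orP[/eqP//|]; rewrite eqn0Ngt w0_gt0.
right=> w /prop.
have -> : weight s w0 = size w0.
  by apply/eqP; rewrite eqn_leq le dvdn_leq.
by rewrite mulnC => /eqP; rewrite eqn_pmul2l// => /eqP.
Qed.

(** * Growth and boundedness of the output variance *)

Hypothesis A_gt0 : (0 < #|A|)%N.

Lemma card_word_gt0 n : (0 < #|{: n.-tuple A}|)%N.
Proof. by rewrite card_tuple expn_gt0 A_gt0. Qed.

(** As [P] survives extension, the finitely many witnesses can be padded with an arbitrary letter to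
    one length. *)
Lemma uniform_length (P : Q -> seq A -> Prop) :
  (forall s u w, P s u -> P s (u ++ w)) -> (forall s, exists u, P s u) ->
  exists2 L, (0 < L)%N & forall s, exists u : L.-tuple A, P s u.
Proof.
move=> Pcat /choice[f Pf].
have /card_gt0P[x _] := A_gt0.
exists (\max_s size (f s)).+1 => // s.
pose u := f s ++ nseq ((\max_s size (f s)).+1 - size (f s)) x.
have su : size u == (\max_s size (f s)).+1.
  rewrite size_cat size_nseq subnKC// ltnW// ltnS.
  exact: (leq_bigmax (F := fun s => size (f s))).
by exists (Tuple su); apply: Pcat.
Qed.

(** Law of total variance, conditioning on the first [L] letters: conditional variance plus squared
    deviation of the conditional mean. *)
Lemma output_var_cat L n s : output_var (L + n) s =
  uniform_expectation (fun u : L.-tuple A => output_var n (run s u) +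
    ((weight s u)%:R +
      uniform_expectation (fun w : n.-tuple A => output (run s u) w) -
     uniform_expectation (fun w : (L + n).-tuple A => output s w)) ^+ 2).
Proof.
rewrite /output_var {1}/uniform_variance.
set M := uniform_expectation (fun w : (L + n).-tuple A => output s w).
transitivity (uniform_expectation (fun u : L.-tuple A =>
    uniform_expectation (fun w : n.-tuple A => (output s (u ++ w) - M) ^+ 2))).
  exact: (uexp_cat L n (fun w => (output s w - M) ^+ 2)).
apply: eq_uexp => u.
set m := uniform_expectation (fun w : n.-tuple A => output (run s u) w).
have -> : ((weight s u)%:R + m - M) = m - (M - (weight s u)%:R) by ring.
rewrite -uexp_sqrB; last exact: card_word_gt0.
by apply: eq_uexp => w; rewrite output_cat; congr (_ ^+ 2); ring.
Qed.

(* By the law of total variance over the first [L] letters, each block adds a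
   positive constant: it contains two words which lead to the same state with
   different weights. *)
Lemma output_var_lower_bound L :
  (forall s, exists u u' : L.-tuple A,
    run s u = run s u' /\ weight s u <> weight s u') ->
  forall k s, k%:R * (4 * #|{: L.-tuple A}|%:R)^-1 <= output_var (k * L) s.
Proof.
move=> split; elim=> [|k IH] s; first by rewrite mul0r uvar_ge0.
have [u [u' [euu' nuu']]] := split s.
rewrite mulSn output_var_cat uexpD -natr1 mulrDl mul1r; apply: lerD.
  rewrite -[leLHS](uexp_cst (card_word_gt0 L)).
  by apply: ler_uexp => w; apply: IH.
set Z := (X in uniform_expectation X).
have Z0 v : 0 <= Z v by apply: sqr_ge0.
(* The conditional means after [u] and [u'] differ by the integer difference of the weights, hence
   by at least 1, so they are not both within 1/2 of the overall mean. *)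
have Zbig : exists v, 4^-1 <= Z v.
  apply/not_existsP => small.
  have /negP := small u; have /negP := small u'.
  rewrite -!ltNge /Z -euu'.
  set m := uniform_expectation _; set M := uniform_expectation _.
  suff : 1 <= ((weight s u)%:R - (weight s u')%:R) ^+ 2 :> R.
    set x : R := (weight s u)%:R; set y : R := (weight s u')%:R.
    have := sqr_ge0 (x + m - M + (y + m - M)).
    have -> : (x + m - M + (y + m - M)) ^+ 2 = 2 * (x + m - M) ^+ 2 +
       2 * (y + m - M) ^+ 2 - (x - y) ^+ 2 by ring.
    lra.
  have : (weight s u < weight s u')%N \/ (weight s u' < weight s u)%N by lia.
  by case; rewrite -(ler_nat R) -natr1 => ?; nra.
have [v Zv] := Zbig.
apply: le_trans (uexp_ge_point v Z0).
by rewrite invfM ler_wpM2r ?invr_ge0.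
Qed.

Lemma weight_absorbed (F : {set Q}) (c : bool) :
  (forall s x, s \in F -> next s x \in F) ->
  (forall s x, s \in F -> label s x = c) ->
  forall s w, s \in F -> weight s w = (c * size w)%N.
Proof.
move=> Fnext Flabel s w; elim: w s => [|x w IH] s sF /=.
  by rewrite muln0.
by rewrite Flabel// IH ?Fnext// mulnS.
Qed.

(* With [D] the output minus [c * size], a block of [L] letters changes [D] by
   at most [L], and with probability at least [r] it ends in [F], where
   [|D| <= 1] from then on.  Since [(x + y)^2 <= (1 + r) x^2 + (1 + 1/r) y^2], a
   bound [B] on the second moment is preserved as soon as
   [(1 + r) (B - r (B - 1)) + (1 + 1/r) L^2 <= B]. *)
Lemma output_var_upper_bound L (F : {set Q}) (c : bool) :
  (forall s x, s \in F -> next s x \in F) ->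
  (forall s x, s \in F -> label s x = c) ->
  (forall s, `|a s| <= 1) ->
  (forall s, exists u : L.-tuple A, run s u \in F) ->
  exists B, forall k s, output_var (k * L) s <= B.
Proof.
move=> Fnext Flabel a1 reach.
pose D s w : R := output s w - c%:R * (size w)%:R.
pose M2 n s := uniform_expectation (fun w : n.-tuple A => D s w ^+ 2).
have DF s w : s \in F -> D s w ^+ 2 <= 1.
  move=> sF; rewrite /D /output (weight_absorbed Fnext Flabel)// natrM.
  rewrite [_ + a _]addrC addrK -real_normK ?num_real// expr_le1//.
(* The probability of a single block of length [L]. *)
pose r : R := #|{: L.-tuple A}|%:R^-1.
have r_gt0 : 0 < r by rewrite invr_gt0 ltr0n card_word_gt0.
pose K : R := (1 + r^-1) * L%:R ^+ 2.
have K0 : 0 <= K by rewrite mulr_ge0 ?sqr_ge0// addr_ge0// invr_ge0 ltW.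
(* The solution of the condition on [B] with equality, as [BK] records. *)
pose B := 1 + (r + K) / r ^+ 2.
have B1 : 1 <= B.
  by rewrite /B lerDl divr_ge0 ?sqr_ge0// addr_ge0// ltW.
have BK : (1 + r) * (B - r * (B - 1)) + K = B.
  by rewrite /B; field; apply: lt0r_neq0.
suff main k s : M2 (k * L)%N s <= B.
  exists B => k s; apply: le_trans (main k s).
  apply: le_trans (uvar_le_sqrB (card_word_gt0 _) _ (c%:R * (k * L)%:R)) _.
  by apply: ler_uexp => w; rewrite /D size_tuple.
elim: k s => [|k IH] s.
  rewrite /M2 /uniform_expectation; apply: le_trans B1.
  rewrite -[leRHS](uexp_cst (card_word_gt0 (0 * L))).
  apply: ler_uexp => w; rewrite tuple0 /D /output /= mulr0 subr0 add0r.
  by rewrite -real_normK ?num_real// expr_le1.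
rewrite mulSn /M2.
have -> := uexp_cat L (k * L) (fun w => D s w ^+ 2).
rewrite -[leRHS]BK.
have step (u : L.-tuple A) :
    uniform_expectation (fun w : (k * L).-tuple A => D s (u ++ w) ^+ 2) <=
    (1 + r) * M2 (k * L)%N (run s u) + K.
  rewrite -(uexp_cst (card_word_gt0 (k * L)) K) /M2 -uexpZ -uexpD.
  apply: ler_uexp => w.
  pose y : R := (weight s u)%:R - c%:R * L%:R.
  have -> : D s (u ++ w) = D (run s u) w + y.
    by rewrite /D output_cat size_cat size_tuple natrD /y; ring.
  have y2 : y ^+ 2 <= L%:R ^+ 2.
    have : (weight s u)%:R <= L%:R :> R.
      by rewrite ler_nat -{2}(size_tuple u) weight_le_size.
    have : 0 <= (weight s u)%:R :> R by [].
    by rewrite /y; case: (c) => /=; nra.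
  have := mulr_ge0 (ltW r_gt0) (sqr_ge0 (D (run s u) w - r^-1 * y)).
  rewrite /K; set x := D _ _.
  have -> : r * (x - r^-1 * y) ^+ 2 = r * x ^+ 2 - 2 * x * y + r^-1 * y ^+ 2.
    field; exact: lt0r_neq0.
  have : (1 + r^-1) * y ^+ 2 <= (1 + r^-1) * L%:R ^+ 2.
    by rewrite ler_wpM2l// addr_ge0// invr_ge0 ltW.
  nra.
apply: le_trans (ler_uexp step) _.
rewrite uexpD uexpZ (uexp_cst (card_word_gt0 L)) lerD2r ler_wpM2l//.
  by rewrite addr_ge0// ltW.
have [u0 u0F] := reach s.
have M2F : M2 (k * L)%N (run s u0) <= 1.
  rewrite -[leRHS](uexp_cst (card_word_gt0 (k * L))).
  by apply: ler_uexp => w; apply: DF.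
(* The gap is at least [B - 1] at [u0], which has probability [r], so the mean of [M2] after a block
   is at most [B - r * (B - 1)]. *)
have gap0 (u : L.-tuple A) : 0 <= B - M2 (k * L)%N (run s u).
  by rewrite subr_ge0.
have := uexp_ge_point u0 gap0; rewrite -/r uexpD (uexp_cst (card_word_gt0 L)).
have -> : uniform_expectation (fun u : L.-tuple A => - M2 (k * L)%N (run s u))
   = - uniform_expectation (fun u : L.-tuple A => M2 (k * L)%N (run s u)).
  rewrite -mulN1r -uexpZ; by apply: eq_uexp => u; rewrite mulN1r.
nra.
Qed.

(** Otherwise a word leading to [s0], followed by [u] or by [w], gives from every state two words of
    equal length and end state but different weights, and the variance grows linearly along
    multiples of a common length. *)
Lemma closed_weight_eq_of_bounded_var (C : R) N s0 :
  (forall s, exists u, run s u = s0) ->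
  (forall n, (N <= n)%N -> exists s, output_var n s <= C) ->
  forall u w, closed_word s0 u -> closed_word s0 w ->
    size u = size w -> weight s0 u = weight s0 w.
Proof.
move=> reach bounded u w su sw euw; apply/eqP/contraT => /eqP nuw.
pose P s v := exists v', [/\ size v' = size v, run s v = run s v' &
  weight s v <> weight s v'].
have [L L_gt0 PL] : exists2 L, (0 < L)%N &
    forall s, exists v : L.-tuple A, P s v.
  apply: uniform_length => [s v v1 [v' [e1 e2 ne]]|s].
    exists (v' ++ v1); rewrite !size_cat !run_cat !weight_cat e1 e2; split=> //.
    lia.
  have [v sv] := reach s; exists (v ++ u), (v ++ w).
  rewrite !size_cat euw !run_cat !weight_cat sv; split=> //; last lia.
  by rewrite su sw.
pose d : R := (4 * #|{: L.-tuple A}|%:R)^-1.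
have d_gt0 : 0 < d by rewrite invr_gt0 mulr_gt0// ltr0n card_word_gt0.
(* Large enough for the bound [C] to apply at length [k * L] and for [k * d] to exceed [C]. *)
pose k := maxn N (Num.truncn (C / d)).+1.
have [|s] := bounded (k * L)%N.
  by rewrite (leq_trans (leq_maxl N (Num.truncn (C / d)).+1))// leq_pmulr.
apply: contraTT => _; rewrite -ltNge.
have lower : k%:R * d <= output_var (k * L) s.
  apply: output_var_lower_bound => t.
  have [v [v' [e1 e2 ne]]] := PL t.
  have sv' : size v' == L by rewrite e1 size_tuple.
  by exists v, (Tuple sv').
apply: lt_le_trans lower; rewrite -ltr_pdivrMr//.
by apply: lt_le_trans (truncnS_gt _) _; rewrite ler_nat leq_maxr.
Qed.

End Automaton.

Lemma le0_of_natmul_bounded (R : realType) (x C : R) (N : nat) :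
  (forall k, (N <= k)%N -> x * k%:R <= C) -> x <= 0.
Proof.
move=> bnd; rewrite leNgt; apply/negP => x_gt0.
pose k := maxn N (Num.truncn (C / x)).+1.
have := bnd k (leq_maxl _ _); rewrite leNgt => /negP; apply.
rewrite mulrC -ltr_pdivrMr//.
by apply: lt_le_trans (truncnS_gt _) _; rewrite ler_nat leq_maxr.
Qed.

(** * The complete deterministic transducer as an automaton *)

Section Transducer.
Variables (R : realType) (T : transducer R) (a : state T -> R).

(** The default [s] only makes the function total; completeness excludes that case. *)
Definition next_state (s : state T) (x : in_alphabet T) : state T :=
  if [pick t | (s, t, x) \in transitions T] is Some t then t else s.

Definition label_one (s : state T) (x : in_alphabet T) : bool :=
  out_label (s, next_state s x, x) == 1.

Local Notation trun := (run next_state).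
Local Notation tweight := (weight next_state label_one).
Local Notation toutput := (output next_state label_one a).

Hypothesis Tcomplete : complete_transducer T.

Lemma next_stateP s x : (s, next_state s x, x) \in transitions T.
Proof.
rewrite /next_state; case: pickP => // none.
by have [t] := Tcomplete s x; rewrite none.
Qed.

Lemma adjacent_next_state (s : state T) x :
  @Defs.adjacent R T s (next_state s x).
Proof. by apply/existsP; exists x; apply: next_stateP. Qed.

Lemma next_state_final (s : state T) x :
  s \in final_states T -> next_state s x \in final_states T.
Proof.
rewrite !inE => /forallP sF; apply/forallP => t.
exact: connect_trans (sF t) (connect1 (adjacent_next_state s x)).
Qed.

Lemma final_transition (s : state T) x : s \in final_states T ->
  (s, next_state s x, x) \in final_transitions T.
Proof. by move=> sF; rewrite inE next_stateP sF next_state_final. Qed.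

Hypothesis Tout : out_alphabet T = [set 0; 1]%classic.

Lemma out_label_next s x :
  out_label (s, next_state s x, x) = (label_one s x)%:R.
Proof.
have := out_labelP (next_stateP s x); rewrite /label_one Tout => -[] -> //=.
  by rewrite eq_sym oner_eq0.
by rewrite eqxx.
Qed.

Hypothesis Tdet : deterministic T.

Lemma next_state_unique s t x :
  (s, t, x) \in transitions T -> next_state s x = t.
Proof. exact: Tdet (next_stateP s x). Qed.

Lemma sum_output_from s w : \sum_(x <- output_from a s w) x = toutput s w.
Proof.
elim: w s => [|x w IH] s /=; first by rewrite big_seq1 /output /= add0r.
case: pickP => [t tT|none]; last by have [t] := Tcomplete s x; rewrite none.
rewrite -(next_state_unique tT) big_cons IH out_label_next.
by rewrite /output /= natrD addrA.
Qed.

(** Reversal permutes the words of length [n], so the reading direction does not affect the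
    variance. *)
Lemma uvar_output_sum n : uniform_variance (@output_sum R T a n) =
  output_var next_state label_one a n (initial_state T).
Proof.
pose rev_word (w : n.-tuple (in_alphabet T)) := rev_tuple w.
have rev_bij : bijective rev_word.
  by exists rev_word => w; apply: val_inj; apply: revK.
rewrite -(uvar_bij _ rev_bij); apply: eq_uvar => w.
by rewrite /output_sum /= revK sum_output_from.
Qed.

Lemma connect_run (s t : state T) :
  connect (@Defs.adjacent R T) s t -> exists u, trun s u = t.
Proof.
move=> /connectP[p]; elim: p s => [|y p IH] s /=.
  by move=> _ ->; exists [::].
move=> /andP[/existsP[x /next_state_unique sy] /IH{}IH /IH[u yu]].
by exists (x :: u); rewrite /= sy.
Qed.

Lemma final_states_run (s t : state T) :
  t \in final_states T -> exists u, trun s u = t.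
Proof. by rewrite inE => /forallP/(_ s)/connect_run. Qed.

(** Turns closed walks into closed words, so that aperiodicity yields the gcd condition on the
    latter. *)
Lemma run_walk (s : state T) p t : is_walk (final_transitions T) s p t ->
  trun s [seq e.2 | e <- p] = t.
Proof.
elim: p s => [|[[s1 t1] x] p IH] s /=; first by move/eqP.
move=> /and3P[]; rewrite inE => /andP[/next_state_unique et _] /eqP <-.
by rewrite et; apply: IH.
Qed.

End Transducer.

(** * Vanishing of the asymptotic variance *)

Lemma asymptotic_variance_bound (R : realType) (T : transducer R)
    (a : state T -> R) (v : R) : is_asymptotic_variance T a v ->
  exists (C : R) (N : nat), forall n, (N <= n)%N ->
    `|uniform_variance (@output_sum R T a n) - v * n%:R| <= C.
Proof.
move=> /eqaddOP/bigO_exP[C _ [N _ NP]]; exists C, N => n /NP.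
by rewrite /= normr1 mulr1.
Qed.

Theorem corollary3p6 (R : realType) (T : transducer R) (a : state T -> R)
    (Tsub : subsequential T a) (Tcomplete : complete_transducer T)
    (Tconn : finally_connected T) (Taper : finally_aperiodic T)
    (Tout : out_alphabet T = [set 0; 1]%classic)
    (v2 : R) (v2P : is_asymptotic_variance T a v2) :
  v2 = 0 <->
  (forall e, e \in final_transitions T -> out_label e = 0) \/
  (forall e, e \in final_transitions T -> out_label e = 1).
Proof.
have [Tdet aT] := Tsub; have [s0 s0F] := Tconn.
have A_gt0 : (0 < #|{: in_alphabet T}|)%N.
  by rewrite -cardfE (leq_trans _ (in_alphabet_ge2 T)).
have [C [N CN]] := asymptotic_variance_bound v2P.
have final_run s := final_states_run Tcomplete Tdet s s0F.
split=> [v20|labels].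
- have same := closed_weight_eq_of_bounded_var (a := a) A_gt0 (C := C) (N := N)
    final_run.
  have [|d dvd_d|weight0|weight1] := closed_weight_dichotomy
      (next := @next_state R T) (label := @label_one R T) (s := s0).
  + apply: same => n Nn; exists (initial_state T).
    have := CN n Nn; rewrite v20 mul0r subr0 uvar_output_sum//.
    exact/le_trans/ler_norm.
  + rewrite (Taper s0 s0F d) => l [p /(run_walk Tcomplete Tdet) pw <-].
    by have := dvd_d _ pw; rewrite size_map.
  (* Every final transition lies on a closed word [u ++ x :: w] at [s0]; weight 0 of the whole
     forces label 0. *)
  + left=> -[[s t] x]; rewrite inE /= => /andP[eT /andP[sF tF]].
    have est := next_state_unique Tcomplete Tdet eT.
    have [u su] := final_states_run Tcomplete Tdet s0 sF.
    have [w tw] := final_run t.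
    have := weight0 (u ++ x :: w); rewrite /closed_word run_cat su /= est.
    rewrite weight_cat su /= est => /(_ tw) /eqP; rewrite !addn_eq0.
    have := out_label_next Tcomplete Tout s x; rewrite est => -> /and3P[_ + _].
    by case: label_one.
  + right=> -[[s t] x]; rewrite inE /= => /andP[eT /andP[sF tF]].
    have est := next_state_unique Tcomplete Tdet eT.
    have [u su] := final_states_run Tcomplete Tdet s0 sF.
    have [w tw] := final_run t.
    have := weight1 (u ++ x :: w); rewrite /closed_word run_cat su /= est.
    rewrite weight_cat su /= est => /(_ tw); rewrite size_cat /=.
    (* Since [u] and [w] weigh at most their lengths, full weight of the closed word forces label 1
       on [x]. *)
    have := weight_le_size (@next_state R T) (@label_one R T) s0 u.
    have := weight_le_size (@next_state R T) (@label_one R T) t w.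
    have := out_label_next Tcomplete Tout s x; rewrite est => ->.
    by case: label_one => //=; lia.
- have [c cP] : exists c : bool, forall s x, s \in final_states T ->
      label_one s x = c.
    case: labels => lab; [exists false|exists true] => s x sF;
      rewrite /label_one lab ?final_transition//.
      by rewrite eq_sym oner_eq0.
    by rewrite eqxx.
  have [L L_gt0 reachL] : exists2 L, (0 < L)%N & forall s,
      exists u : L.-tuple (in_alphabet T),
        run (@next_state R T) s u \in final_states T.
    (* The final component is closed under transitions, so longer words stay in it. *)
    apply: (uniform_length A_gt0
      (P := fun s u => run (@next_state R T) s u \in final_states T))
      => [s u w|s].
      rewrite run_cat; elim: w (run _ s u) => //= x w IH t tF.
      by apply: IH; apply: next_state_final.
    by have [u su] := final_run s; exists u; rewrite su.
  have a1 s : `|a s| <= 1.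
    by have := aT s; rewrite Tout => -[] ->; rewrite ?normr0 ?normr1.
  have [B BP] := output_var_upper_bound A_gt0
    (next_state_final Tcomplete) cP a1 reachL.
  apply/eqP; rewrite eq_le; apply/andP; split.
    have L0 : 0 < L%:R :> R by rewrite ltr0n.
    (* The variance is bounded only along multiples of [L], so the sign of [v2 * L] is tested. The
       opposite inequality follows from nonnegativity of the variance. *)
    rewrite -(pmulr_lle0 v2 L0).
    apply: (@le0_of_natmul_bounded _ _ (B + C) N) => k Nk.
    have := CN (k * L)%N (leq_trans Nk (leq_pmulr _ L_gt0)).
    rewrite uvar_output_sum// ler_norml => /andP[+ _].
    have := BP k (initial_state T).
    by rewrite natrM; lra.
  rewrite -oppr_le0; apply: (@le0_of_natmul_bounded _ _ C N) => k /CN.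
  rewrite ler_norml => /andP[_].
  have := uvar_ge0 (@output_sum R T a k); lra.
Qed.
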